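(* Let $p$ be a parity for a class $B$ of free $n$-strand braids. Let $\beta$ be a free $n$-strand braid-word, representing a braid from $B$, all of whose classical crossings are odd with respect to $p$. Then $$[\beta]_p=\beta,$$ where on the left-hand side $\beta$ is considered as an element of $\mathcal{FB}_n$, and on the right-hand side $\beta$ is an element of $\mathcal{F}_n$.
   Context: **Groups.** $\mathcal{F}_n$ is the group generated by $\zeta_1,\dots,\zeta_{n-1},\tau_1,\dots,\tau_{n-1}$ subject to the relations: (1) $\tau_i^2=1$, $\zeta_i^2=1$ for $i=1,\dots,n-1$ (second Reidemeister moves); (2) $\tau_i\zeta_i=\zeta_i\tau_i$ for $i=1,\dots,n-1$ (virtualization); (3) $\zeta_i\zeta_j=\zeta_j\zeta_i$, $\zeta_i\tau_j=\tau_j\zeta_i$, $\tau_i\tau_j=\tau_j\tau_i$ for $|i-j|\ge 2$ (far commutativity); (4) $\tau_i\tau_{i+1}\tau_i=\tau_{i+1}\tau_i\tau_{i+1}$ for $i=1,\dots,n-2$; (5) $\tau_i\tau_{i+1}\zeta_i=\zeta_{i+1}\tau_i\tau_{i+1}$ for $i=1,\dots,n-2$. The free $n$-strand braid group $\mathcal{FB}_n$ is the quotient of $\mathcal{F}_n$ by the relations $\zeta_i\zeta_{i+1}\zeta_i=\zeta_{i+1}\zeta_i\zeta_{i+1}$, $i=1,\dots,n-2$ (third Reidemeister moves). A free $n$-strand braid is an element of $\mathcal{FB}_n$. A braid-word is a finite word in the letters $\zeta_i,\tau_i$ ($1\le i\le n-1$). Occurrences of letters $\zeta_i$ in a word are called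 classical crossings. Words are read from top to bottom, so ''upper'' means the first and ''lower'' the last letter. **Parity.** Let $B$ be a set of free $n$-strand braids. A parity for braids from $B$ is a way of associating elements of $\mathbb{Z}_2$ (even $=0$, odd $=1$) with all classical crossings of all braid-words representing braids from $B$ such that: 1. If two braid-words $ApC$ and $AqC$ are obtained from one another by applying a defining relation $p\to q$ of $\mathcal{FB}_n$, then the parities of all crossings belonging to $A$ or to $C$ do not change. 2. For $\zeta_i\zeta_j\to\zeta_j\zeta_i$, $|i-j|\ge2$, the parity of $\zeta_i$ on the left-hand side equals that of $\zeta_i$ on the right-hand side, and likewise for $\zeta_j$. 3. For $\zeta_i\tau_j\to\tau_j\zeta_i$, $|i-j|\ge 2$, the parity of $\zeta_i$ does not change. 4. For $\zeta_i^2\to 1$, both letters $\zeta_i$ on the left have the same parity. 5. For $\zeta_i\zeta_{i+1}\zeta_i\to\zeta_{i+1}\zeta_i\zeta_{i+1}$: (a) the number of odd crossings among the three on the left is even; (b) the parity of the upper $\zeta_i$ on the left equals that of the lower $\zeta_{i+1}$ on the right; (c) the parity of the middle $\zeta_{i+1}$ on the left equals that of the middle $\zeta_i$ on the right; (d) the parity of the lower $\zeta_i$ on the left equals that of the upper $\zeta_{i+1}$ on the right. 6. For $\tau_i\tau_{i+1}\zeta_i\to\zeta_{i+1}\tau_i\tau_{i+1}$, the parity of $\zeta_i$ on the left equals that of $\zeta_{i+1}$ on the right. 7. For $\zeta_i\tau_i\to\tau_i\zeta_i$, the parity of $\zeta_i$ does not change. **One-term parity bracket.** For a braid-word $\beta$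 representing a braid from $B$, $[\beta]_p$ is the $n$-strand braid-word obtained from $\beta$ by removing all letters $\zeta_i$ that are even with respect to $p$ (all letters $\tau_i$ are kept). It induces a well-defined map, also denoted $[\cdot]_p$, from $B\subseteq\mathcal{FB}_n$ to $\mathcal{F}_n$: the value on a free braid is the class in $\mathcal{F}_n$ of $[\beta]_p$ for any braid-word $\beta$ representing it. *)

(* Defs.v *)
From HB Require Import structures.
From Stdlib Require Import Relation_Operators.
From mathcomp Require Import all_boot.
From mathcomp Require Import boolp classical_sets.

Set Implicit Arguments.
Unset Strict Implicit.
Unset Printing Implicit Defensive.

Local Open Scope quotient_scope.

(* A presentation on the generators A in which every generator is involutive.
   Then a = a^-1 for each generator, so the group it presents is the set of
   words in the generators themselves (no formal inverses), modulo the
   congruence generated by the relations; the inverse of a class is the class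
   of the reversed word. *)
Record involutive_presentation (A : choiceType) := InvolutivePresentation {
  relator :> seq A -> seq A -> Prop;
  relator_sqr : forall a, relator [:: a; a] [::]
}.

Inductive rewrites (A : Type) (R : seq A -> seq A -> Prop) :
  seq A -> seq A -> Prop :=
| Rewrites u p q v : R p q -> rewrites R (u ++ p ++ v) (u ++ q ++ v).

Section PresentedGroup.
Variables (A : choiceType) (R : involutive_presentation A).
Implicit Types u v w : seq A.

Definition word_equiv : seq A -> seq A -> Prop :=
  clos_refl_sym_trans _ (rewrites R).

Lemma word_equiv_cat u u' v v' :
  word_equiv u u' -> word_equiv v v' -> word_equiv (u ++ v) (u' ++ v').
Proof.
move=> uu' vv'; apply: (@rst_trans _ _ _ (u' ++ v)).
  elim: uu' => {u u'} [_ _ [u p q w Rpq]|u|u u' _ IH|u u' u'' _ IH _ IH'].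
  - by rewrite -!catA; apply/rst_step/Rewrites.
  - exact: rst_refl.
  - exact: rst_sym.
  - exact: rst_trans IH IH'.
elim: vv' => {v v'} [_ _ [v p q w Rpq]|v|v v' _ IH|v v' v'' _ IH _ IH'].
- by rewrite !(catA u'); apply/rst_step/Rewrites.
- exact: rst_refl.
- exact: rst_sym.
- exact: rst_trans IH IH'.
Qed.

Lemma word_equiv_rev_cat w : word_equiv (rev w ++ w) [::].
Proof.
elim: w => [|a w IHw]; first exact: rst_refl.
apply: rst_trans IHw; rewrite rev_cons cat_rcons.
apply: word_equiv_cat; first exact: rst_refl.
exact/rst_step/(Rewrites [::] w (relator_sqr R a)).
Qed.

Lemma word_equiv_rev u v : word_equiv u v -> word_equiv (rev u) (rev v).
Proof.
move=> uv; have vV : word_equiv (v ++ rev v) [::].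
  by rewrite -{1}(revK v); apply: word_equiv_rev_cat.
have E1 : word_equiv (rev u) ((rev u ++ v) ++ rev v).
  rewrite -catA -{1}(cats0 (rev u)).
  by apply: word_equiv_cat; [exact: rst_refl | exact: rst_sym].
apply: rst_trans E1 _; rewrite -{2}(cat0s (rev v)).
apply: word_equiv_cat; last exact: rst_refl.
apply: (@rst_trans _ _ _ (rev u ++ u)); last exact: word_equiv_rev_cat.
by apply: word_equiv_cat; [exact: rst_refl | exact: rst_sym].
Qed.

Definition word_eqb : rel (seq A) := fun u v => `[< word_equiv u v >].

Lemma word_eqb_refl : reflexive word_eqb.
Proof. by move=> u; apply/asboolP/rst_refl. Qed.

Lemma word_eqb_sym : symmetric word_eqb.
Proof. by move=> u v; apply/asboolP/asboolP; apply: rst_sym. Qed.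

Lemma word_eqb_trans : transitive word_eqb.
Proof.
by move=> v u w /asboolP uv /asboolP vw; apply/asboolP/(rst_trans _ _ _ _ _ uv).
Qed.

Definition word_eqb_rel := EquivRel word_eqb
  word_eqb_refl word_eqb_sym word_eqb_trans.

Definition presented_group : Type := {eq_quot word_eqb_rel}.

HB.instance Definition _ := Choice.on presented_group.
HB.instance Definition _ := EqQuotient.on presented_group.

Lemma eq_classP u v :
  \pi_presented_group u = \pi_presented_group v <-> word_equiv u v.
Proof. by split=> [/eqmodP/asboolP|uv] //; apply/eqmodP/asboolP. Qed.

Lemma word_equiv_repr u : word_equiv (repr (\pi_presented_group u)) u.
Proof. by apply/eq_classP; rewrite reprK. Qed.

Definition presented_one : presented_group := \pi_presented_group [::].
Definition presented_mul (x y : presented_group) : presented_group :=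
  \pi_presented_group (repr x ++ repr y).
Definition presented_inv (x : presented_group) : presented_group :=
  \pi_presented_group (rev (repr x)).

Lemma presented_mulE u v :
  presented_mul (\pi u) (\pi v) = \pi_presented_group (u ++ v).
Proof. by apply/eq_classP/word_equiv_cat; apply: word_equiv_repr. Qed.

Lemma presented_invE u : presented_inv (\pi u) = \pi_presented_group (rev u).
Proof. by apply/eq_classP/word_equiv_rev/word_equiv_repr. Qed.

Lemma presented_mulA : associative presented_mul.
Proof.
move=> x y z; rewrite -[x]reprK -[y]reprK -[z]reprK.
by rewrite !presented_mulE catA.
Qed.

Lemma presented_mul1 : left_id presented_one presented_mul.
Proof. by move=> x; rewrite -[x]reprK presented_mulE. Qed.

Lemma presented_mulr1 : right_id presented_one presented_mul.
Proof. by move=> x; rewrite -[x]reprK presented_mulE cats0. Qed.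

Lemma presented_mulV : left_inverse presented_one presented_inv presented_mul.
Proof.
move=> x; rewrite -[x]reprK presented_invE presented_mulE.
exact/eq_classP/word_equiv_rev_cat.
Qed.

Lemma presented_mulrV : right_inverse presented_one presented_inv presented_mul.
Proof.
move=> x; rewrite -[x]reprK presented_invE presented_mulE.
by apply/eq_classP; rewrite -{1}(revK (repr x)); apply: word_equiv_rev_cat.
Qed.

HB.instance Definition _ := isGroup.Build presented_group
  presented_mulA presented_mul1 presented_mulr1 presented_mulV presented_mulrV.

End PresentedGroup.

(* On n strands the letters are indexed by 'I_n.-1, that is, from 0 instead of
   from 1. *)
Inductive letter (n : nat) := zeta of 'I_n.-1 | tau of 'I_n.-1.

Definition sum_of_letter n (x : letter n) : 'I_n.-1 + 'I_n.-1 :=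
  match x with zeta i => inl i | tau i => inr i end.

Definition letter_of_sum n (s : 'I_n.-1 + 'I_n.-1) : letter n :=
  match s with inl i => zeta i | inr i => tau i end.

Lemma sum_of_letterK n : cancel (@sum_of_letter n) (@letter_of_sum n).
Proof. by case. Qed.

HB.instance Definition _ n :=
  Countable.copy (letter n) (can_type (@sum_of_letterK n)).

(* The head of the list is the uppermost letter. *)
Notation braid_word n := (seq (letter n)).

Definition is_zeta n (x : letter n) : bool := if x is zeta _ then true else false.

Definition far n (i j : 'I_n.-1) : bool := (i + 2 <= j) || (j + 2 <= i).

Inductive F_rel (n : nat) : braid_word n -> braid_word n -> Prop :=
| F_tau_sqr (i : 'I_n.-1) : F_rel [:: tau i; tau i] [::]
| F_zeta_sqr (i : 'I_n.-1) : F_rel [:: zeta i; zeta i] [::]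
| F_virtualization (i : 'I_n.-1) : F_rel [:: tau i; zeta i] [:: zeta i; tau i]
| F_far_zeta_zeta i j : far i j ->
    F_rel [:: zeta i; zeta j] [:: zeta j; zeta i]
| F_far_zeta_tau i j : far i j ->
    F_rel [:: zeta i; tau j] [:: tau j; zeta i]
| F_far_tau_tau i j : far i j ->
    F_rel [:: tau i; tau j] [:: tau j; tau i]
| F_tau_tau_tau (i j : 'I_n.-1) : j = i.+1 :> nat ->
    F_rel [:: tau i; tau j; tau i] [:: tau j; tau i; tau j]
| F_tau_tau_zeta (i j : 'I_n.-1) : j = i.+1 :> nat ->
    F_rel [:: tau i; tau j; zeta i] [:: zeta j; tau i; tau j].

Inductive FB_rel (n : nat) : braid_word n -> braid_word n -> Prop :=
| FB_of_F p q : F_rel p q -> FB_rel p q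
| FB_zeta_zeta_zeta (i j : 'I_n.-1) : j = i.+1 :> nat ->
    FB_rel [:: zeta i; zeta j; zeta i] [:: zeta j; zeta i; zeta j].

Lemma F_rel_sqr n (x : letter n) : F_rel [:: x; x] [::].
Proof. by case: x => i; constructor. Qed.

Definition F_presentation n := InvolutivePresentation (@F_rel_sqr n).

Definition FB_presentation n :=
  InvolutivePresentation (fun x : letter n => FB_of_F (F_rel_sqr x)).

Definition F (n : nat) : groupType := presented_group (F_presentation n).

Definition FB (n : nat) : groupType := presented_group (FB_presentation n).

Definition F_class n (w : braid_word n) : F n :=
  \pi_(presented_group (F_presentation n)) w.

Definition FB_class n (w : braid_word n) : FB n :=
  \pi_(presented_group (FB_presentation n)) w.

Definition classical_at n (w : braid_word n) (k : nat) : bool :=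
  nth false (map (@is_zeta n) w) k.

(* An assignment of parities: c w k is the parity of the k-th letter of w
   (k counted from 0), with true = 1 = odd. Only the values at the classical
   crossings k of words w representing braids from B are meaningful: is_parity
   constrains no other value. *)
Notation crossing_parities n := (braid_word n -> nat -> bool).

Record is_parity n (B : set (FB n)) (c : crossing_parities n) : Prop := {
  parity_outside : forall a p q d, FB_rel p q ->
    B (FB_class (a ++ p ++ d)) ->
    (forall k, classical_at a k -> c (a ++ p ++ d) k = c (a ++ q ++ d) k) /\
    (forall k, classical_at d k ->
       c (a ++ p ++ d) (size a + size p + k) =
       c (a ++ q ++ d) (size a + size q + k));
  parity_far_zeta_zeta : forall a d i j, far i j ->
    let L := a ++ [:: zeta i; zeta j] ++ d in
    let R := a ++ [:: zeta j; zeta i] ++ d in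
    B (FB_class L) ->
    c L (size a) = c R (size a + 1) /\ c L (size a + 1) = c R (size a);
  parity_far_zeta_tau : forall a d i j, far i j ->
    let L := a ++ [:: zeta i; tau j] ++ d in
    let R := a ++ [:: tau j; zeta i] ++ d in
    B (FB_class L) -> c L (size a) = c R (size a + 1);
  parity_zeta_sqr : forall a d i,
    let L := a ++ [:: zeta i; zeta i] ++ d in
    B (FB_class L) -> c L (size a) = c L (size a + 1);
  parity_zeta_zeta_zeta : forall a d (i j : 'I_n.-1), j = i.+1 :> nat ->
    let L := a ++ [:: zeta i; zeta j; zeta i] ++ d in
    let R := a ++ [:: zeta j; zeta i; zeta j] ++ d in
    B (FB_class L) ->
    [/\ ~~ odd (c L (size a) + c L (size a + 1) + c L (size a + 2)),
        c L (size a) = c R (size a + 2),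
        c L (size a + 1) = c R (size a + 1) &
        c L (size a + 2) = c R (size a)];
  parity_tau_tau_zeta : forall a d (i j : 'I_n.-1), j = i.+1 :> nat ->
    let L := a ++ [:: tau i; tau j; zeta i] ++ d in
    let R := a ++ [:: zeta j; tau i; tau j] ++ d in
    B (FB_class L) -> c L (size a + 2) = c R (size a);
  parity_virtualization : forall a d i,
    let L := a ++ [:: zeta i; tau i] ++ d in
    let R := a ++ [:: tau i; zeta i] ++ d in
    B (FB_class L) -> c L (size a) = c R (size a + 1)
}.

Definition bracket_word n (c : crossing_parities n) (w : braid_word n) :
  braid_word n :=
  mask (mkseq (fun k => classical_at w k ==> c w k) (size w)) w.

(* The map from B to F n induced by bracket_word: the common class in F n of
   the brackets of all the words representing x, with the junk value 1 when
   these classes do not all agree (as may happen outside B). *)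
Definition bracket n (c : crossing_parities n) (x : FB n) : F n :=
  xget 1%g [set y : F n | forall w, FB_class w = x ->
                           F_class (bracket_word c w) = y]%classic.

(* Main.v *)
Require Import Defs.
From Stdlib Require Import Relation_Operators.
From mathcomp Require Import all_boot boolp classical_sets.

(** The bracket is invariant under every defining relation [u -> v] of [FB n].
    The only relation of [FB n] that does not hold in [F n] is the third
    Reidemeister move: there zero or two of the three crossings are odd, and
    after deletion of the even ones the two sides coincide, except that when
    the middle crossing alone is even they become the squares of [zeta i] and
    [zeta j], both trivial in [F n]. So the bracket of a braid can be computed
    on [beta] itself, where nothing is deleted. *)

Set Implicit Arguments.
Unset Strict Implicit.
Unset Printing Implicit Defensive.

(** Unlike in [bracket_word], the parities [f] do not depend on the word, so deletion can be split
    along a concatenation, each factor reading [f] at its own offset. *)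
Definition keep_odd n (f : nat -> bool) (w : braid_word n) : braid_word n :=
  mask (mkseq (fun k => classical_at w k ==> f k) (size w)) w.

Lemma eq_keep_odd n (f g : nat -> bool) (w : braid_word n) :
  (forall k, classical_at w k -> f k = g k) -> keep_odd f w = keep_odd g w.
Proof.
move=> fg; congr mask; apply: eq_mkseq => k.
by case wk: (classical_at w k) => //=; apply: fg.
Qed.

Lemma keep_odd_cons n f (x : letter n) w :
  keep_odd f (x :: w) =
  nseq (is_zeta x ==> f 0) x ++ keep_odd (fun k => f k.+1) w.
Proof.
rewrite /keep_odd /mkseq /= -[1]/(1 + 0) iotaDl -map_comp.
by case: (is_zeta x ==> f 0).
Qed.

Lemma keep_odd_cat n f (u v : braid_word n) :
  keep_odd f (u ++ v) = keep_odd f u ++ keep_odd (fun k => f (size u + k)) v.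
Proof.
elim: u f => [|x u IHu] f //=.
by rewrite !keep_odd_cons IHu catA.
Qed.

Lemma keep_odd_id n (f : nat -> bool) (w : braid_word n) :
  (forall k, classical_at w k -> f k) -> keep_odd f w = w.
Proof.
(* A constant parity function is unaffected by index shifts, so induction on [w] applies
   directly. *)
move=> fw; rewrite (@eq_keep_odd _ f xpredT) => [|k /fw ->] //.
elim: w {f fw} => [|x w IHw] //.
by rewrite keep_odd_cons IHw implybT.
Qed.

Lemma word_equiv_relator (A : choiceType) (R : involutive_presentation A) u v :
  R u v -> word_equiv R u v.
Proof.
by move=> /(Rewrites [::] [::]); rewrite /= !cats0; apply: rst_step.
Qed.

Section Invariance.
Variables (n : nat) (B : set (FB n)) (c : crossing_parities n).
Hypothesis cP : is_parity B c.

Lemma FB_class_eq (u v : braid_word n) :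
  word_equiv (FB_presentation n) u v -> FB_class u = FB_class v.
Proof. by move=> uv; apply/eq_classP. Qed.

(** Parities are read in the full words, at offset [size a], since they may depend on the
    context. *)
Lemma keep_odd_FB_rel (a d u v : braid_word n) :
  FB_rel u v -> B (FB_class (a ++ u ++ d)) ->
  word_equiv (F_presentation n)
    (keep_odd (fun k => c (a ++ u ++ d) (size a + k)) u)
    (keep_odd (fun k => c (a ++ v ++ d) (size a + k)) v).
Proof.
move=> uv Bu; have Bv : B (FB_class (a ++ v ++ d)).
  by rewrite -(FB_class_eq (rst_step _ _ _ _ (Rewrites a d uv))).
case: uv Bu Bv => {u v} [u v uv|i j ij] Bu Bv.
- case: uv Bu Bv => {u v} [i|i|i|i j ij|i j ij|i j ij|i j ij|i j ij] Bu Bv;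
    rewrite !keep_odd_cons /= ?addn0.
  + exact/word_equiv_relator/F_tau_sqr.
  + rewrite (parity_zeta_sqr cP Bu).
    case: (c _ _); last exact: rst_refl.
    exact/word_equiv_relator/F_zeta_sqr.
  (* The parity axiom starts from the right-hand side of this relator, hence [Bv]. *)
  + rewrite (parity_virtualization cP Bv).
    case: (c _ _); last exact: rst_refl.
    exact/word_equiv_relator/F_virtualization.
  + have [-> ->] := parity_far_zeta_zeta cP ij Bu.
    by do 2!case: (c _ _); try exact: rst_refl;
       apply/word_equiv_relator/F_far_zeta_zeta.
  + rewrite (parity_far_zeta_tau cP ij Bu).
    case: (c _ _); last exact: rst_refl.
    exact/word_equiv_relator/F_far_zeta_tau.
  + exact/word_equiv_relator/F_far_tau_tau.
  + exact/word_equiv_relator/F_tau_tau_tau.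
  + rewrite (parity_tau_tau_zeta cP ij Bu).
    case: (c _ _); last exact: rst_refl.
    exact/word_equiv_relator/F_tau_tau_zeta.
- have [even_c c0 c1 c2] := parity_zeta_zeta_zeta cP ij Bu.
  rewrite !keep_odd_cons /= !addn0 -c0 -c1 -c2.
  move: even_c {c0 c1 c2}; (do 3!case: (c _ _)) => //= _; try exact: rst_refl.
  (* Only the pattern odd, even, odd is left. *)
  apply: (@rst_trans _ _ _ [::]); last apply: rst_sym;
    exact/word_equiv_relator/F_zeta_sqr.
Qed.

Lemma bracket_word_FB_rel (a d u v : braid_word n) :
  FB_rel u v -> B (FB_class (a ++ u ++ d)) ->
  word_equiv (F_presentation n) (bracket_word c (a ++ u ++ d))
    (bracket_word c (a ++ v ++ d)).
Proof.
move=> uv Bu; have [eq_a eq_d] := parity_outside cP uv Bu.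
have wordE w : bracket_word c w = keep_odd (c w) w by [].
rewrite !wordE !keep_odd_cat.
rewrite (eq_keep_odd eq_a); apply: word_equiv_cat; first exact: rst_refl.
apply: word_equiv_cat; first exact: keep_odd_FB_rel.
rewrite (@eq_keep_odd _ _
  (fun k => c (a ++ v ++ d) (size a + (size v + k)))); first exact: rst_refl.
by move=> k /eq_d; rewrite !addnA.
Qed.

(** Membership in [B] depends only on the class, so it persists along a chain of rewritings and the
    parity axioms apply at each step. *)
Lemma bracket_word_equiv (u v : braid_word n) :
  word_equiv (FB_presentation n) u v -> B (FB_class u) ->
  word_equiv (F_presentation n) (bracket_word c u) (bracket_word c v).
Proof.
elim=> {u v} [_ _ [a u v d uv]|u|u v uv IHuv|u v w uv IHuv _ IHvw] Bu.
- exact: bracket_word_FB_rel.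
- exact: rst_refl.
- by apply/rst_sym/IHuv; rewrite (FB_class_eq uv).
- by apply: rst_trans (IHuv Bu) (IHvw _); rewrite -(FB_class_eq uv).
Qed.

Lemma bracketE (w : braid_word n) :
  B (FB_class w) -> bracket c (FB_class w) = F_class (bracket_word c w).
Proof.
(* Invariance shows that the bracket of [w] is a common value, and [w] itself forces uniqueness; the
   default [1] is not reached. *)
move=> Bw; apply: xget_unique => [u /esym /eq_classP wu|y /(_ w erefl) //].
by apply/esym/eq_classP/bracket_word_equiv.
Qed.

End Invariance.

Theorem corollary1 (n : nat) (B : set (FB n)) (p : crossing_parities n)
    (hp : is_parity B p) (beta : braid_word n) (hB : B (FB_class beta))
    (hodd : forall k : nat, classical_at beta k -> p beta k) :
  bracket p (FB_class beta) = F_class beta.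
Proof.
by rewrite (bracketE hp hB); congr F_class; apply: keep_odd_id.
Qed.
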